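(* Let $(G,\lambda)$ be an MAT-labeled graph with vertex set $N_G=[\ell]$. Let $\mathcal{P}$ be the poset whose elements are the sets $\{i\}$ for $1\le i\le\ell$ together with all principal cliques of $(G,\lambda)$, ordered by inclusion, with rank function $\operatorname{rk}_{\mathcal{P}}(v)=|v|$. Then $\mathcal{P}$ is an LR-vine. In particular, if $G$ is a complete graph, then $\mathcal{P}$ is an R-vine.
   Context: Graphs are finite, simple and undirected. An edge-labeled graph $(G,\lambda)$ is a graph $G$ with a map $\lambda\colon E_G\to\mathbb{Z}_{>0}$; $\pi_k=\lambda^{-1}(k)$, and $\pi_{<k},\pi_{\le k}$ are the sets of edges of label $<k$, $\le k$. For an edge $\{u,v\}\in\pi_k$, a conditioning vertex is a vertex $h$ with $\{u,h\},\{v,h\}\in E_G$ both of label $<k$. $\lambda$ is an MAT-labeling (and $(G,\lambda)$ an MAT-labeled graph) if for every $k\in\mathbb{Z}_{>0}$: (ML1) no edge $e\in\pi_{\le k}$ forms a cycle with edges in $\pi_k$; (ML2) every edge in $\pi_k$ has exactly $k-1$ conditioning vertices. For $e=\{i,j\}\in\pi_k$ with conditioning vertices $h_1,\dots,h_{k-1}$, the principal clique generated by $e$ is $K_e=\{i,j,h_1,\dots,h_{k-1}\}$; the principal cliques of $(G,\lambda)$ are the sets $K_e$, $e\in E_G$. Posets are finite. A graded poset has rank function $\operatorname{rk}$ with $x<y\Rightarrow \operatorname{rk}(x)<\operatorname{rk}(y)$, $\operatorname{rk}(y)=\operatorname{rk}(x)+1$ when $y$ covers $x$, and minimal elements of rank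 $1$; $\mathcal{P}_i$ = elements of rank $i$, $\dim(\mathcal{P})$ = number of minimal elements, $\mathcal{E}(v)$ = set of elements covered by $v$. A vine is a graded poset in which every non-minimal element covers exactly two elements, any two distinct elements of the same rank are covered by at most one common element, and for each $1\le i\le\operatorname{rk}(\mathcal{P})$ the graph $F_i$ on $\mathcal{P}_i$ with edge set $\{\mathcal{E}(v)\mid v\in\mathcal{P}_{i+1}\}$ is a forest. An R-vine is a vine with $\operatorname{rk}(\mathcal{P})=\dim(\mathcal{P})$, each $F_i$ a tree, and proximity: distinct elements of the same rank $i\ge2$ covered by a common element cover a common element. An LR-vine is a vine all of whose principal ideals $\mathcal{P}_{\le v}$ (induced order and rank) are R-vines. *)

(* Defs.v *)
From mathcomp Require Import all_boot all_order.

Set Implicit Arguments.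
Unset Strict Implicit.
Unset Printing Implicit Defensive.

Import Order.TTheory.

Section Graphs.
Variable T : finType.

Record graph := Graph { vertices : {set T}; edges : {set {set T}} }.

Definition simple_graph (G : graph) : Prop :=
  forall e, e \in edges G -> e \subset vertices G /\ #|e| = 2.

Definition adj (G : graph) : rel T := fun x y => [set x; y] \in edges G.

Definition complete_graph (G : graph) : Prop :=
  {in vertices G &, forall x y, x != y -> adj G x y}.

Definition is_cycle (G : graph) (c : seq T) : Prop :=
  3 <= size c /\ ucycle (adj G) c.

Definition cycle_edges (c : seq T) : {set {set T}} :=
  [set [set x; next c x] | x in c].

Definition forest (G : graph) : Prop :=
  simple_graph G /\ forall c, ~ is_cycle G c.

Definition tree (G : graph) : Prop :=
  [/\ forest G, vertices G != set0
    & {in vertices G &, forall x y, connect (adj G) x y}].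

(* Edge labels are given by a function on all sets of vertices; only its values
   on the edges of G are ever used. *)
Definition label_class (G : graph) (lambda : {set T} -> nat) (k : nat) :
  {set {set T}} := [set e in edges G | lambda e == k].

Definition label_class_le (G : graph) (lambda : {set T} -> nat) (k : nat) :
  {set {set T}} := [set e in edges G | lambda e <= k].

Definition label_class_lt (G : graph) (lambda : {set T} -> nat) (k : nat) :
  {set {set T}} := [set e in edges G | lambda e < k].

(* No h \in e qualifies, since [set h; h] is not an edge of a simple graph. *)
Definition conditioning_vertices (G : graph) (lambda : {set T} -> nat)
  (e : {set T}) : {set T} :=
  [set h in vertices G |
    [forall u in e, [set u; h] \in label_class_lt G lambda (lambda e)]].

Definition ML1 (G : graph) (lambda : {set T} -> nat) (k : nat) : Prop :=
  forall e c, e \in label_class_le G lambda k -> is_cycle G c ->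
    e \in cycle_edges c -> ~ cycle_edges c \subset e |: label_class G lambda k.

Definition ML2 (G : graph) (lambda : {set T} -> nat) (k : nat) : Prop :=
  forall e, e \in label_class G lambda k ->
    #|conditioning_vertices G lambda e| = k - 1.

Definition MAT_labeled_graph (G : graph) (lambda : {set T} -> nat) : Prop :=
  [/\ simple_graph G, forall e, e \in edges G -> 0 < lambda e
    & forall k, 0 < k -> ML1 G lambda k /\ ML2 G lambda k].

Definition principal_clique (G : graph) (lambda : {set T} -> nat)
  (e : {set T}) : {set T} := e :|: conditioning_vertices G lambda e.

Definition clique_poset (G : graph) (lambda : {set T} -> nat) :
  {set {set T}} :=
  [set [set i] | i in vertices G]
    :|: [set principal_clique G lambda e | e in edges G].

End Graphs.

(* A finite poset is a subset P of an ambient finite partial order, with the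
   induced order; covering and minimality are relative to P. *)
Section Vines.
Context {d : Order.disp_t} {T : finPOrderType d}.
Local Open Scope order_scope.

(* covers P y x: y covers x in P. *)
Definition covers (P : {set T}) (y x : T) : bool :=
  [&& x \in P, y \in P, x < y & ~~ [exists z in P, (x < z) && (z < y)]].

Definition minimal_elements (P : {set T}) : {set T} :=
  [set x in P | ~~ [exists y in P, y < x]].

Definition covered_by (P : {set T}) (v : T) : {set T} :=
  [set x | covers P v x].

Definition graded_poset (P : {set T}) (rk : T -> nat) : Prop :=
  [/\ {in P &, forall x y, x < y -> (rk x < rk y)%N},
      {in P &, forall x y, covers P y x -> rk y = (rk x).+1}
    & {in minimal_elements P, forall x, rk x = 1%N}].

Definition poset_rank (P : {set T}) (rk : T -> nat) : nat :=
  (\max_(x in P) rk x)%N.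

Definition poset_dim (P : {set T}) : nat := #|minimal_elements P|.

Definition level (P : {set T}) (rk : T -> nat) (i : nat) : {set T} :=
  [set x in P | rk x == i].

Definition level_graph (P : {set T}) (rk : T -> nat) (i : nat) : graph T :=
  Graph (level P rk i) [set covered_by P v | v in level P rk i.+1].

Definition vine (P : {set T}) (rk : T -> nat) : Prop :=
  [/\ graded_poset P rk,
      {in P, forall v, v \notin minimal_elements P -> #|covered_by P v| = 2%N},
      {in P &, forall x y, x != y -> rk x = rk y ->
         forall v w, covers P v x -> covers P v y ->
           covers P w x -> covers P w y -> v = w}
    & forall i, (1 <= i <= poset_rank P rk)%N -> forest (level_graph P rk i)].

Definition proximity (P : {set T}) (rk : T -> nat) : Prop :=
  forall i x y, (2 <= i)%N -> x \in level P rk i -> y \in level P rk i ->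
    x != y -> (exists v, covers P v x && covers P v y) ->
    exists z, covers P x z && covers P y z.

Definition R_vine (P : {set T}) (rk : T -> nat) : Prop :=
  [/\ vine P rk, poset_rank P rk = poset_dim P,
      forall i, (1 <= i <= poset_rank P rk)%N -> tree (level_graph P rk i)
    & proximity P rk].

Definition principal_ideal (P : {set T}) (v : T) : {set T} :=
  [set x in P | x <= v].

Definition LR_vine (P : {set T}) (rk : T -> nat) : Prop :=
  vine P rk /\ {in P, forall v, R_vine (principal_ideal P v) rk}.

End Vines.

(* Main.v *)
Require Import Defs.
From mathcomp Require Import all_boot all_order.
From mathcomp Require Import zify.
(* orders {set T} by inclusion *)
Import Order.DefaultSetSubsetOrder.

(* By ML1 every triangle has a unique edge of largest label, so by ML2 an edge
   of label k is the largest edge of exactly k - 1 triangles. Applied to a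
   largest edge of a clique, this shows that a clique with all labels < k has at
   most k vertices.

   Let G_k be the graph of the edges of label < k. It is chordal, by induction
   on k: if uv has label k and N is its set of conditioning vertices, then N
   separates u from v even in G_{k+1} minus uv (cond_separates), and adding an
   edge between two vertices separated by common neighbours keeps a graph
   chordal. Since G_k has no induced 4-cycle, principal cliques are cliques; it
   follows that the elements of rank n are exactly the n-cliques of G_n.

   If S is the principal clique of uv, it covers exactly S \ u and S \ v. A cycle
   of a level graph using this edge would give a path from v to u off N avoiding the
   edge uv, against the separation property. The ideal below S is the clique poset
   of the complete graph induced on S. *)

(** * Chordal relations, and adding an edge between separated vertices *)

Section Chordal.
Set Implicit Arguments.
Unset Strict Implicit.
Unset Printing Implicit Defensive.
Variable T : finType.
Implicit Types (r : rel T) (S N : {set T}).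

Lemma set2_eq (x y u v : T) :
  ([set x; y] == [set u; v]) =
  (x == u) && (y == v) || (x == v) && (y == u).
Proof.
apply/eqP/orP => [/setP E | [] /andP[/eqP-> /eqP->] //]; last by rewrite setUC.
have := E x; have := E y; have := E u; have := E v.
rewrite !inE !eqxx ?orbT /= (eq_sym v) (eq_sym v) (eq_sym u) (eq_sym u).
case: (x =P u) => [->|_]; case: (y =P v) => [->|_]; rewrite ?eqxx ?orbT ?orbF;
  move=> *; try (by left); try (by right; apply/andP).
Qed.

Lemma connect_invariant r (P : T -> Prop) x y :
  (forall a b, P a -> r a b -> P b) -> connect r x y -> P x -> P y.
Proof.
move=> Pr /connectP[p + ->]; elim: p x => //= z p IH x /andP[rxz pz] Px.
exact: IH pz (Pr _ _ Px rxz).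
Qed.

Definition rel_in r S x y := [&& r x y, x \in S & y \in S].
Arguments rel_in r S x y /.

Lemma rel_in_sym r S : symmetric r -> connect_sym (rel_in r S).
Proof. by move=> rC; apply: sym_connect_sym => x y /=; rewrite rC [(x \in S) && _]andbC. Qed.

Lemma connect_rel_in r r' S S' :
  subrel r r' -> S \subset S' ->
  subrel (connect (rel_in r S)) (connect (rel_in r' S')).
Proof.
move=> rr' /subsetP SS'; apply: connect_sub => x y /and3P[rxy xS yS].
by apply: connect1; rewrite /= rr' ?SS'.
Qed.

(* For finite irreflexive symmetric r this says that r has no induced cycle of
   length at least 4: on such a cycle, two neighbours of h are connected off h
   but not inside the neighbourhood of h. *)
Definition chordal r := forall S h u v,
  h \notin S -> u \in S -> v \in S -> r h u -> r h v ->
  connect (rel_in r S) u v -> connect (rel_in r [set x in S | r h x]) u v.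

Lemma chordal_ext r r' : r =2 r' -> chordal r -> chordal r'.
Proof.
move=> E ch S h u v hS uS vS; rewrite -!E => hu hv c.
have E' A : connect (rel_in r' A) =2 connect (rel_in r A).
  by apply: eq_connect => x y /=; rewrite E.
rewrite E' in c; rewrite E'; have -> : [set x in S | r' h x] = [set x in S | r h x].
  by apply/setP=> x; rewrite !inE E.
exact: ch.
Qed.

(** Otherwise [h], [u], [h'], [v] would be an induced 4-cycle: [u] and [v] are connected through
    [h'], but not inside the neighbours of [h] in [[set u; v; h']], which are just [u] and [v]. *)
Lemma chordal_common_nbrs r h h' u v :
  symmetric r -> irreflexive r -> chordal r ->
  u != v -> ~~ r u v -> h != h' ->
  r h u -> r h v -> r h' u -> r h' v -> r h h'.
Proof.
move=> rC rI ch uv ruv hh' hu hv h'u h'v; apply: contraNT uv => rhh'.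
have /ch : h \notin [set u; v; h'].
  rewrite !inE !negb_or hh' andbT.
  by apply/andP; split; apply/eqP=> E; [move: hu|move: hv]; rewrite E rI.
move=> /(_ u v); rewrite !inE !eqxx !orbT /= => /(_ isT isT hu hv) c.
have {}c : connect (rel_in r [set x in [set u; v; h'] | r h x]) u v.
  by apply: c; apply: (connect_trans (y := h')); apply: connect1;
    rewrite /= !inE !eqxx ?orbT ?h'v // rC h'u.
rewrite eq_sym; apply/eqP.
apply: (connect_invariant (P := fun w => w = u) _ c) => // a b ->.
rewrite /= !inE => /and3P[rub _ /andP[/orP[/orP[]|] /eqP E rhb]] //; subst b.
- by rewrite rub in ruv.
- by rewrite rhb in rhh'.
Qed.

(** Chordality is applied to the members of [s] in turn, each time shrinking [S] to the neighbours
    of the current one. *)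
Lemma chordal_complete r S (s : seq T) x y :
  chordal r -> {in s, forall h, h \notin S} -> x \in S -> y \in S ->
  {in s, forall h, r h x} -> {in s, forall h, r h y} ->
  connect (rel_in r S) x y ->
  connect (rel_in r [set z in S | all (fun h => r h z) s]) x y.
Proof.
move=> ch; elim: s S => [|h s IH] S sS xS yS sx sy c.
  by apply: connect_rel_in c => //; apply/subsetP=> z; rewrite inE => ->.
have hs : {subset s <= h :: s} by move=> z; rewrite inE orbC => ->.
have hh : h \in h :: s by rewrite mem_head.
have := IH [set z in S | r h z].
rewrite !inE xS yS sx // sy //=.
have -> : [set z in [set z in S | r h z] | all (fun h => r h z) s] =
          [set z in S | r h z && all (fun h => r h z) s].
  by apply/setP=> z; rewrite !inE andbA.
apply=> //; try by move=> z /hs; auto.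
- by move=> z /hs/sS; rewrite inE negb_and => ->.
- by apply: ch => //; [exact: sS | exact: sx | exact: sy].
Qed.

Definition add_edge r (u v x y : T) :=
  [|| r x y, (x == u) && (y == v) | (x == v) && (y == u)].
Arguments add_edge r u v x y /.

Lemma add_edge_sym r u v : symmetric r -> symmetric (add_edge r u v).
Proof. by move=> rC x y /=; rewrite rC; do !case: (_ == _); rewrite ?orbT ?orbF. Qed.

Lemma add_edgeC r u v : add_edge r u v =2 add_edge r v u.
Proof. by move=> x y /=; do !case: (_ == _); rewrite ?orbT ?orbF. Qed.

(** Repeated crossings of the new edge can be reduced to at most one; the last two cases are its two
    directions. *)
Lemma connect_add_edge r u v S a b :
  u \in S -> v \in S ->
  connect (rel_in (add_edge r u v) S) a b ->
  let c := connect (rel_in r S) in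
  [\/ c a b, c a u /\ c v b | c a v /\ c u b].
Proof.
move=> uS vS cab c.
apply: (connect_invariant (P := fun b => [\/ c a b, c a u /\ c v b | c a v /\ c u b]) _ cab);
  last by constructor 1; exact: connect0.
move=> x y Hx /and3P[rxy xS yS].
case/or3P: rxy => [rxy|/andP[/eqP ? /eqP ?]|/andP[/eqP ? /eqP ?]]; subst.
- have cxy : c x y by apply: connect1; rewrite /= rxy xS.
  case: Hx => [|[]|[]] *; [constructor 1|constructor 2|constructor 3] => //;
    try split=> //; by apply: connect_trans cxy.
- by case: Hx => [|[]|[]] *; [constructor 2|constructor 2|constructor 1] => //;
    split=> //; exact: connect0.
- by case: Hx => [|[]|[]] *; [constructor 3|constructor 1|constructor 3] => //;
    split=> //; exact: connect0.
Qed.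

Section AddEdge.
Variables (r : rel T) (u v : T) (N : {set T}).
Hypotheses (rC : symmetric r) (rI : irreflexive r) (rch : chordal r).
Hypotheses (Nu : {in N, forall h, r h u}) (Nv : {in N, forall h, r h v}).
Hypothesis (Nsep : ~~ connect (rel_in r (~: N)) u v).

Local Notation r' := (add_edge r u v).

Let uN : u \notin N. Proof. by apply/negP => /Nu; rewrite rI. Qed.
Let vN : v \notin N. Proof. by apply/negP => /Nv; rewrite rI. Qed.

Let rr' : subrel r r'. Proof. by move=> x y rxy; rewrite /= rxy. Qed.

(** A vertex [n] of [N] in [S] is an old neighbour of [u] adjacent to [v], so old chordality at [u]
    links it to [b]. If [S] misses [N], going from [v] to [b] and on to [u] contradicts [Nsep]. *)
Lemma add_edge_chordal_end S b :
  u \notin S -> v \in S -> b \in S -> r u b -> connect (rel_in r S) v b ->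
  connect (rel_in r' [set x in S | r' u x]) v b.
Proof.
move=> uS vS bS ub cvb.
have [S0|[n]] := set_0Vmem (S :&: N); last first.
  rewrite inE => /andP[nS nN].
  have cnb : connect (rel_in r [set x in S | r u x]) n b.
    apply: rch => //; first by rewrite rC Nu.
    by apply: connect_trans cvb; apply: connect1; rewrite /= Nv // nS.
  apply: (connect_trans (y := n)).
    by apply: connect1; rewrite /= !inE nS vS !eqxx /= ![r _ n]rC Nu // Nv // orbT.
  apply: connect_rel_in cnb => //.
  by apply/subsetP=> x; rewrite !inE => /andP[-> /rr'].
have SN : S \subset ~: N by rewrite subsets_disjoint setCK -setI_eq0 S0.
case/negP: Nsep; rewrite (rel_in_sym _ rC).
apply: (connect_trans (y := b)); first exact: connect_rel_in cvb.
by apply: connect1; rewrite /= rC ub (subsetP SN) // inE uN.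
Qed.

Lemma connect_add_edge_out S : (u \notin S) || (v \notin S) ->
  connect (rel_in r' S) =2 connect (rel_in r S).
Proof.
move=> uvS; apply: eq_connect => x y /=.
apply/and3P/and3P=> -[rxy xS yS]; split=> //; last by rewrite rxy.
by case/or3P: rxy => // /andP[/eqP ? /eqP ?]; subst; rewrite xS yS in uvS.
Qed.

(** Since [u] is outside [S], the new edge does not occur inside [S]; it only makes [v] a neighbour
    of [u], which is the case of [add_edge_chordal_end]. *)
Lemma add_edge_chordal_at S a b :
  u \notin S -> a \in S -> b \in S -> r' u a -> r' u b ->
  connect (rel_in r' S) a b -> connect (rel_in r' [set x in S | r' u x]) a b.
Proof.
move=> uS aS bS; rewrite connect_add_edge_out ?uS //.
have E x : x \in S -> r' u x -> r u x \/ x = v.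
  move=> xS /or3P[-> | /andP[_ /eqP->] | /andP[_ /eqP xu]]; [by left|by right|].
  by rewrite -xu xS in uS.
move=> /(E a aS)[ua|av] /(E b bS)[ub|bv] cab; subst.
- have := rch uS aS bS ua ub cab; apply: connect_rel_in => //.
  by apply/subsetP=> x; rewrite !inE => /andP[-> /rr'].
- rewrite rel_in_sym; last exact: add_edge_sym.
  by apply: add_edge_chordal_end; rewrite // rel_in_sym.
- exact: add_edge_chordal_end.
- exact: connect0.
Qed.

(** The case of a path crossing the new edge. If [h] is in [N], it is adjacent to [u] and [v], and
    each half is treated by old chordality. If [S] meets [N], an old path goes from [u] to [v]
    there. Otherwise [u], [a], [h], [b], [v] are connected off [N], against [Nsep]. *)
Lemma add_edge_chordal_off S h a b :
  h \notin S -> u \in S -> v \in S -> a \in S -> b \in S -> r h a -> r h b ->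
  connect (rel_in r S) a u -> connect (rel_in r S) v b ->
  connect (rel_in r' [set x in S | r' h x]) a b.
Proof.
move=> hS uS vS aS bS ha hb cau cvb.
have sub : subrel (connect (rel_in r [set x in S | r h x]))
                  (connect (rel_in r' [set x in S | r' h x])).
  apply: connect_rel_in => //.
  by apply/subsetP=> x; rewrite !inE => /andP[-> /rr'].
have [hN|hN] := boolP (h \in N).
  apply: (connect_trans (y := u)); first by apply: sub; apply: rch; rewrite ?Nu.
  apply: (connect_trans (y := v)); last by apply: sub; apply: rch; rewrite ?Nv.
  by apply: connect1; rewrite /= !inE uS vS !eqxx (Nu hN) (Nv hN) !orbT.
have [S0|[n]] := set_0Vmem (S :&: N); last first.
  rewrite inE => /andP[nS nN]; apply: sub; apply: rch => //.
  apply: connect_trans cau _; apply: connect_trans cvb.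
  by apply: (connect_trans (y := n)); apply: connect1; rewrite /= nS ?uS ?vS ?[r u n]rC ?Nu ?Nv.
have SN : S \subset ~: N by rewrite subsets_disjoint setCK -setI_eq0 S0.
case/negP: Nsep.
apply: (connect_trans (y := a)).
  by rewrite (rel_in_sym _ rC); apply: connect_rel_in cau.
apply: (connect_trans (y := b)); last by rewrite (rel_in_sym _ rC); apply: connect_rel_in cvb.
have hN' : h \in ~: N by rewrite inE.
by apply: (connect_trans (y := h)); apply: connect1; rewrite /= hN' ?(subsetP SN) ?[r a h]rC ?ha ?hb.
Qed.

End AddEdge.

Lemma chordal_add_edge r u v N :
  symmetric r -> irreflexive r -> chordal r ->
  {in N, forall h, r h u} -> {in N, forall h, r h v} ->
  ~~ connect (rel_in r (~: N)) u v -> chordal (add_edge r u v).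
Proof.
move=> rC rI rch Nu Nv Nsep S h a b.
have Nsep' : ~~ connect (rel_in r (~: N)) v u by rewrite rel_in_sym.
have off := add_edge_chordal_off rC rch Nu Nv Nsep.
have off' := add_edge_chordal_off rC rch Nv Nu Nsep'.
have E A : connect (rel_in (add_edge r u v) A) =2 connect (rel_in (add_edge r v u) A).
  by apply: eq_connect => x y; rewrite /rel_in add_edgeC.
have E' A : [set x in A | add_edge r u v h x] = [set x in A | add_edge r v u h x].
  by apply/setP=> x; rewrite inE add_edgeC inE.
have [->|hu] := eqVneq h u; first exact: (add_edge_chordal_at rC rI rch Nu Nv Nsep).
have [hv|hv] := eqVneq h v.
  rewrite E' !E hv !(add_edgeC r u v).
  exact: (add_edge_chordal_at rC rI rch Nv Nu Nsep').
have at_h x : add_edge r u v h x = r h x by rewrite /= (negPf hu) (negPf hv) !orbF.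
move=> hS aS bS; rewrite !at_h => ha hb cab.
have in_r : connect (rel_in r S) a b ->
    connect (rel_in (add_edge r u v) [set x in S | add_edge r u v h x]) a b.
  move=> /(rch _ _ _ _ hS aS bS ha hb); apply: connect_rel_in.
    by move=> x y /= ->.
  by apply/subsetP=> x; rewrite !inE at_h.
have [uv|uv] := boolP ((u \notin S) || (v \notin S)).
  by apply: in_r; rewrite -(connect_add_edge_out r uv).
have {uv} [uS vS] : u \in S /\ v \in S.
  by move: uv; rewrite negb_or !negbK => /andP.
have [/in_r//|[cau cvb]|[cav cub]] := connect_add_edge uS vS cab.
- exact: off.
- by rewrite E' E; apply: off'.
Qed.

Lemma cycle_avoid r x y z p :
  cycle r [:: x, y, z & p] -> uniq [:: x, y, z & p] ->
  connect [rel a b | r a b && ([set a; b] != [set x; y])] y x.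
Proof.
move=> /and3P[_ yz zp] /and3P[xnotin ynotin _].
have [xy xz] : x != y /\ x != z.
  by move: xnotin; rewrite !inE !negb_or => /and3P[].
have yz' : y != z by move: ynotin; rewrite inE negb_or => /andP[].
apply: (connect_trans (y := z)).
  by apply: connect1; rewrite /= yz set2_eq ![_ == x]eq_sym (negPf xz) (negPf xy) ![z == _]eq_sym ?andbF.
apply/connectP; exists (rcons p x); last by rewrite last_rcons.
(* From [z] on, the path never meets [y], so it cannot use the edge [xy]. *)
apply: (@sub_in_path _ (predC1 y) r) zp.
  move=> a b; rewrite !inE => ay yb rab; rewrite /= rab set2_eq.
  by rewrite (negPf ay) (negPf yb) andbF.
apply/allP=> a; rewrite -rcons_cons mem_rcons inE => /orP[/eqP->//|az].
by apply: contraNneq ynotin => <-.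
Qed.

End Chordal.

(** * Triangles and cliques in an MAT-labeled graph *)

Section MATLabeling.
Set Implicit Arguments.
Unset Strict Implicit.
Unset Printing Implicit Defensive.
Variables (T : finType) (G : graph T) (lambda : {set T} -> nat).
Hypothesis HG : MAT_labeled_graph G lambda.
Implicit Types (S N : {set T}).

Local Notation cond := (conditioning_vertices G lambda).
Local Notation K := (principal_clique G lambda).

Definition lt_adj k x y := [set x; y] \in label_class_lt G lambda k.

Lemma lt_adjE k x y : lt_adj k x y = adj G x y && (lambda [set x; y] < k).
Proof. by rewrite /lt_adj inE. Qed.

Lemma adjC : symmetric (adj G).
Proof. by move=> x y; rewrite /adj setUC. Qed.

Lemma lt_adjC k : symmetric (lt_adj k).
Proof. by move=> x y; rewrite /lt_adj setUC. Qed.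

Lemma adj_neq x y : adj G x y -> x != y.
Proof.
have [sG _ _] := HG => /sG[_]; rewrite cards2.
by case: (x != y).
Qed.

Lemma adj_irr : irreflexive (adj G).
Proof. by move=> x; apply/negP => /adj_neq; rewrite eqxx. Qed.

Lemma lt_adj_irr k : irreflexive (lt_adj k).
Proof. by move=> x; rewrite lt_adjE adj_irr. Qed.

Lemma adj_vertices x y : adj G x y -> (x \in vertices G) && (y \in vertices G).
Proof.
have [sG _ _] := HG => /sG[/subsetP s _].
by rewrite !s // !inE eqxx ?orbT.
Qed.

Lemma lambda_gt0 x y : adj G x y -> 0 < lambda [set x; y].
Proof. by have [_ l0 _] := HG; apply: l0. Qed.

Lemma edge_pair e : e \in edges G -> exists u v, e = [set u; v] /\ adj G u v.
Proof.
move=> eG; have [sG _ _] := HG; have [_ /eqP/cards2P[u [v [_ E]]]] := sG _ eG.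
by exists u, v; rewrite /adj -E.
Qed.

Lemma lt_adj_leq k m : k <= m -> subrel (lt_adj k) (lt_adj m).
Proof. by move=> km x y; rewrite !lt_adjE => /andP[-> /leq_trans->]. Qed.

Lemma lt_adjS k x y :
  lt_adj k.+1 x y = lt_adj k x y || adj G x y && (lambda [set x; y] == k).
Proof. by rewrite !lt_adjE ltnS leq_eqVlt orbC andb_orr. Qed.

Definition class_adj k (e : {set T}) x y :=
  [set x; y] \in label_class G lambda k :\ e.

Lemma next_at_last (y0 y : T) p :
  uniq (y :: p) -> next_at (last y p) y0 y p = y0.
Proof.
elim: p y => [|z p IH] y /=; first by rewrite eqxx.
move=> /andP[yzp up]; rewrite IH //.
by case: eqP => // E; rewrite -E mem_last in yzp.
Qed.

(** A path in label [k] avoiding [uv] would close up with [uv] to a cycle forbidden by ML1. *)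
Lemma ML1_connect k u v :
  adj G u v -> lambda [set u; v] <= k ->
  ~~ connect (class_adj k [set u; v]) u v.
Proof.
move=> uv lk; apply/negP => /connectP[p0 p0P].
case/shortenP: p0P => p pP up _ vE.
have k0 : 0 < k by apply: leq_trans lk; apply: lambda_gt0.
have [_ _ /(_ k k0) [ml1 _]] := HG.
pose R x y := [set x; y] \in [set u; v] |: label_class G lambda k.
have cR : cycle R (u :: p).
  rewrite /= rcons_path -vE {2}/R [[set v; u]]setUC setU11 andbT.
  by apply: sub_path pP => x y; rewrite /class_adj /R !inE => /andP[_ ->]; rewrite orbT.
apply: (ml1 [set u; v] (u :: p)).
- by rewrite inE lk andbT.
- split.
    (* The cycle has length at least 3: an empty [p] would make [uv] a loop, and a single step would
       be the excluded edge [uv]. *)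
    case: p pP vE {up cR} => [_ E|w [|//] /=]; first by rewrite E adj_irr in uv.
    by rewrite /class_adj andbT => wP E; rewrite E !inE eqxx in wP.
  rewrite /ucycle up andbT; apply: sub_cycle cR => x y.
  by rewrite /R !inE => /orP[/eqP|/andP[xy _]]; rewrite /adj // => ->.
- apply/imsetP; exists v; first by rewrite vE mem_last.
  by rewrite [next _ _]/= vE next_at_last // -vE setUC.
- apply/subsetP=> e /imsetP[x xp ->].
  exact: (next_cycle cR xp).
Qed.

(** Otherwise [a], [c], [b] is a path in label [m] joining the ends of [ab], against
    [ML1_connect]. *)
Lemma triangle_max_unique m a b c :
  adj G a b -> adj G a c -> adj G b c ->
  lambda [set a; b] <= m -> lambda [set a; c] = m -> lambda [set b; c] != m.
Proof.
move=> ab ac bc lab lac; apply/negP=> /eqP lbc.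
case/negP: (ML1_connect ab lab).
have [nac nbc] := (adj_neq ac, adj_neq bc).
apply: (connect_trans (y := c)); apply: connect1; rewrite /class_adj !inE.
  rewrite -/(adj G a c) ac lac set2_eq !eqxx andbT /=.
  by rewrite [c == b]eq_sym [c == a]eq_sym (negPf nbc) (negPf nac) andbF.
rewrite [[set c; b]]setUC -/(adj G b c) bc lbc set2_eq !eqxx andbT /=.
by rewrite ![c == _]eq_sym (negPf nbc) (negPf nac) !andbF.
Qed.

Lemma mem_cond u v h :
  let k := lambda [set u; v] in
  (h \in cond [set u; v]) = lt_adj k u h && lt_adj k v h.
Proof.
rewrite inE /=; apply/andP/andP => [[_ /forallP uvh]|[uh vh]].
  by have := uvh v; have := uvh u; rewrite !in_set2 !eqxx orbT.
split; first by move: uh; rewrite lt_adjE => /andP[/adj_vertices/andP[]].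
by apply/forallP=> x; rewrite in_set2; apply/implyP=> /orP[]/eqP->.
Qed.

Lemma card_cond u v : adj G u v -> #|cond [set u; v]| = (lambda [set u; v]).-1.
Proof.
move=> uv; have [_ _ /(_ _ (lambda_gt0 uv)) [_ ml2]] := HG.
by rewrite ml2 ?subn1 // inE eqxx andbT.
Qed.

Lemma card_principal u v : adj G u v -> #|K [set u; v]| = (lambda [set u; v]).+1.
Proof.
move=> uv; rewrite cardsU cards2 adj_neq // card_cond //.
rewrite [_ :&: _](_ : _ = set0) ?cards0 ?subn0.
  by have := lambda_gt0 uv; lia.
apply/setP=> h; rewrite in_setI in_set2 mem_cond in_set0.
by case: eqVneq => [->|_]; [|case: eqVneq => [->|//]]; rewrite lt_adj_irr ?andbF.
Qed.

Definition clique k S := {in S &, forall x y, x != y -> lt_adj k x y}.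

(** Take [uv] of largest label in [S]. Any other [h] in [S] forms a triangle with [uv] whose other
    two edges have strictly smaller labels, so [h] is a conditioning vertex. *)
Lemma clique_sub_principal k S : 1 < #|S| -> clique k S ->
  exists u v, [/\ u \in S, v \in S, u != v & S \subset K [set u; v]].
Proof.
move=> /card_gt1P[x0 [y0 [x0S y0S xy0]]] cS.
pose P (p : T * T) := [&& p.1 \in S, p.2 \in S & p.1 != p.2].
have P0 : P (x0, y0) by apply/and3P.
case: (@arg_maxnP _ _ P (fun p => lambda [set p.1; p.2]) P0) => -[u v].
rewrite /P /= => /and3P[uS vS uv] mx; exists u, v; split=> //.
have aS x y : x \in S -> y \in S -> x != y -> adj G x y /\ lambda [set x; y] <= lambda [set u; v].
  move=> xS yS xy; split; first by move: (cS _ _ xS yS xy); rewrite lt_adjE => /andP[].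
  by apply: (mx (x, y)); rewrite /= xS yS.
apply/subsetP=> h hS; rewrite in_setU mem_cond !inE.
have [//|hu /=] := eqVneq h u; have [//|hv /=] := eqVneq h v.
rewrite eq_sym in hu; rewrite eq_sym in hv.
have [uvG _] := aS _ _ uS vS uv.
have [uhG luh] := aS _ _ uS hS hu; have [vhG lvh] := aS _ _ vS hS hv.
rewrite !lt_adjE uhG vhG !ltn_neqAle luh lvh !andbT; apply/andP; split.
- rewrite setUC; apply: (triangle_max_unique (a := v)) => //; rewrite 1?adjC //.
  by rewrite setUC.
- by rewrite setUC; apply: (triangle_max_unique (a := u)); rewrite // adjC.
Qed.

Lemma clique_card k S : 0 < k -> clique k S -> #|S| <= k.
Proof.
move=> k0 cS; have [|S1] := leqP #|S| 1; first by move=> /leq_trans->.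
have [u [v [uS vS uv sub]]] := clique_sub_principal S1 cS.
have := cS _ _ uS vS uv; rewrite lt_adjE => /andP[uvG luv].
by apply: leq_trans (subset_leq_card sub) _; rewrite card_principal.
Qed.

(** * Separation by conditioning vertices, and chordality of [G_k] *)

Section Separation.
Variables (u v : T).
Local Notation k := (lambda [set u; v]).
Local Notation N := (cond [set u; v]).
Hypotheses (uv : adj G u v) (ch : chordal (lt_adj k)).

(** As [uv] has label exactly [k], it is not an edge of [G_k], where all conditioning vertices are
    common neighbours of [u] and [v]. *)
Lemma cond_clique : clique k N.
Proof.
move=> h h'; rewrite !mem_cond => /andP[uh vh] /andP[uh' vh'] hh'.
have nuv : ~~ lt_adj k u v by rewrite lt_adjE ltnn andbF.
apply: (chordal_common_nbrs (lt_adjC k) (lt_adj_irr k) ch (adj_neq uv) nuv hh');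
  by rewrite lt_adjC.
Qed.

(** If [x] and [y] differ, [chordal_complete] gives a path through vertices complete to [N]. Its
    first step [x], [z] together with [N] is a clique of [k + 1] vertices in [G_k], against
    [clique_card]. *)
Lemma cond_complete_unique x y : x \notin N -> y \notin N ->
  {in N, forall h, lt_adj k h x} -> {in N, forall h, lt_adj k h y} ->
  connect (rel_in (lt_adj k) (~: N)) x y -> x = y.
Proof.
move=> xN yN Nx Ny.
have sN : {in enum N, forall h, h \notin ~: N}.
  by move=> h; rewrite mem_enum in_setC negbK.
have sx : {in enum N, forall h, lt_adj k h x} by move=> h; rewrite mem_enum => /Nx.
have sy : {in enum N, forall h, lt_adj k h y} by move=> h; rewrite mem_enum => /Ny.
have [xN' yN'] : x \in ~: N /\ y \in ~: N by rewrite !in_setC.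
move=> /(chordal_complete ch sN xN' yN' sx sy).
case/connectP=> -[|z p] //= /andP[/and3P[xz _]].
rewrite in_set in_setC => /andP[zN /allP Nz] _ _.
have {}Nz : {in N, forall h, lt_adj k h z} by move=> h hN; apply: Nz; rewrite mem_enum.
have /(clique_card (lambda_gt0 uv)) : clique k (x |: (z |: N)).
  move=> a b; rewrite !in_setU !in_set1.
  move=> /or3P[/eqP->|/eqP->|aN] /or3P[/eqP->|/eqP->|bN]; rewrite ?eqxx // => ab;
    try by [exact: Nx | exact: Nz | exact: cond_clique | rewrite lt_adjC //; auto].
have xz' : x != z by apply: contraTneq xz => ->; rewrite lt_adj_irr.
rewrite !cardsU1 !in_setU !in_set1 (negPf xz') (negPf xN) zN card_cond //.
by have := lambda_gt0 uv; lia.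
Qed.

(* Contract the components of G_k off N: each contains at most one vertex
   complete to N, and an edge of label k joining two of them must have N as its
   set of conditioning vertices. So a path from u to v contracts to a path in
   label k avoiding uv, against ML1. *)
Lemma cond_separates :
  ~~ connect (rel_in (fun x y => lt_adj k.+1 x y && ([set x; y] != [set u; v]))
                     (~: N)) u v.
Proof.
pose c := connect (rel_in (lt_adj k) (~: N)).
(* Invariant along the path: the component of [w] off [N] has a vertex [x] complete to [N], reached
   from [u] by the contracted path. *)
pose I w := exists x, [/\ x \notin N, {in N, forall h, lt_adj k h x}, c x w
  & connect (class_adj k [set u; v]) u x].
have uN : u \notin N by rewrite mem_cond lt_adj_irr.
have vN : v \notin N by rewrite mem_cond lt_adj_irr andbF.
have Nu : {in N, forall h, lt_adj k h u} by move=> h; rewrite mem_cond lt_adjC => /andP[].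
have Nv : {in N, forall h, lt_adj k h v} by move=> h; rewrite mem_cond [lt_adj _ h _]lt_adjC => /andP[].
apply/negP=> cuv.
have [x [xN Nx cxv cux]] : I v; last first.
  have xv := cond_complete_unique xN vN Nx Nv cxv.
  by move: cux; rewrite xv; apply/negP; apply: ML1_connect.
apply: (connect_invariant _ cuv); last by exists u; split; rewrite // /c connect0.
move=> w w' [x [xN Nx cxw cux]] /and3P[/andP[ww' ne]].
rewrite !in_setC => wN w'N.
have [cww'|cww'] := boolP (c w w').
  by exists x; split=> //; apply: connect_trans cww'.
move: ww'; rewrite lt_adjS => /orP[ww'|/andP[ww' /eqP lww']].
  by case/negP: cww'; apply: connect1; rewrite /rel_in ww' !in_setC wN.
(* A conditioning vertex of [ww'] outside [N] would connect [w] to [w'] off [N]. Equality follows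
   because both sets have [k - 1] elements. *)
have sub : cond [set w; w'] \subset N.
  apply/subsetP=> h; rewrite mem_cond lww' => /andP[wh w'h].
  apply/negPn/negP => hN; case/negP: cww'.
  by apply: (connect_trans (y := h)); apply: connect1; rewrite /rel_in !in_setC hN ?wN ?w'N ?wh // lt_adjC w'h.
have {sub} E : cond [set w; w'] = N.
  by apply/eqP; rewrite eqEcard sub !card_cond // lww' leqnn.
have Nw : {in N, forall h, lt_adj k h w}.
  by move=> h; rewrite -E mem_cond lww' lt_adjC => /andP[].
have Nw' : {in N, forall h, lt_adj k h w'}.
  by move=> h; rewrite -E mem_cond lww' [lt_adj _ h _]lt_adjC => /andP[].
(* Both [w] and [w'] are complete to [N], so [w] is the vertex [x] of its component and the
   contracted path continues along [ww']. *)
have xw := cond_complete_unique xN wN Nx Nw cxw.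
exists w'; split=> //; first exact: connect0.
apply: connect_trans cux _; rewrite xw; apply: connect1.
by rewrite /class_adj !inE ne -/(adj G w w') ww' lww' eqxx.
Qed.

End Separation.

Lemma lt_adj_chordal k : chordal (lt_adj k).
Proof.
elim: k => [|k IH]; first by move=> S h x y _ _ _; rewrite lt_adjE andbF.
(* The edges of label [k] are added to [G_k] one at a time. *)
pose r s := foldr (fun p r => add_edge r p.1 p.2) (lt_adj k) s.
pose Pk (p : T * T) := adj G p.1 p.2 && (lambda [set p.1; p.2] == k).
have rC s : symmetric (r s) by elim: s => [|p s IHs]; [exact: lt_adjC|exact: add_edge_sym].
have rlt s : subrel (lt_adj k) (r s).
  by elim: s => // p s IHs x y /IHs /=; rewrite /add_edge => ->.
have rS s : all Pk s -> subrel (r s) (lt_adj k.+1).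
  elim: s => [_|p s IHs /= /andP[/andP[pG pk] /IHs{}IHs]]; first exact: lt_adj_leq.
  move=> x y /or3P[/IHs//|/andP[/eqP-> /eqP->]|/andP[/eqP-> /eqP->]].
    by rewrite lt_adjS pG pk orbT.
  by rewrite lt_adjC lt_adjS pG pk orbT.
have rI s : all Pk s -> irreflexive (r s).
  by move=> /rS sub x; apply/negP => /sub; rewrite lt_adj_irr.
have rch s : all Pk s -> chordal (r s).
  elim: s => [_|[u v] s IHs /= /andP[/andP[/= uv /eqP luv] sk]]; first exact: IH.
  (* The edge may be present already, since [enum Pk] lists each edge in both orientations. *)
  have [ruv|ruv] := boolP (r s u v).
    apply: (chordal_ext _ (IHs sk)) => x y; rewrite /= -/(r s).
    apply/idP/or3P => [|[//|/andP[/eqP-> /eqP->]|/andP[/eqP-> /eqP->]] //].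
      by constructor 1.
    by rewrite rC.
  have chk : chordal (lt_adj (lambda [set u; v])) by rewrite luv.
  apply: (@chordal_add_edge _ _ _ _ (cond [set u; v])) => //.
  - exact: rI.
  - exact: IHs.
  - by move=> h; rewrite mem_cond luv lt_adjC => /andP[/rlt].
  - by move=> h; rewrite mem_cond luv [lt_adj _ v _]lt_adjC => /andP[_ /rlt].
  (* The partial graph [r s] lies in [G_{k+1}] minus [uv], so the separation holds there whatever
     edges were added before. *)
  apply: contra (cond_separates uv chk); apply: connect_rel_in => // x y rxy.
  rewrite luv (rS _ sk) //; apply: contra ruv; rewrite set2_eq.
  by move=> /orP[]/andP[/eqP<- /eqP<-] //; rewrite rC.
have allk : all Pk (enum Pk) by apply/allP=> p; rewrite mem_enum.
apply: chordal_ext (rch _ allk) => x y; apply/idP/idP; first exact: rS.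
rewrite lt_adjS => /orP[/rlt //|xyk].
have : (x, y) \in enum Pk by rewrite mem_enum.
elim: (enum Pk) => //= p s IHs; rewrite inE => /orP[/eqP<-|/IHs] /=.
  by rewrite /add_edge !eqxx orbT.
by rewrite /add_edge => ->.
Qed.
End MATLabeling.

(** * Members and covers of the clique poset *)

Section CliquePoset.
Set Implicit Arguments.
Unset Strict Implicit.
Unset Printing Implicit Defensive.
Variables (T : finType) (G : graph T) (lambda : {set T} -> nat).
Hypothesis HG : MAT_labeled_graph G lambda.
Implicit Types (S A B : {set T}).

Local Notation cond := (conditioning_vertices G lambda).
Local Notation K := (principal_clique G lambda).
Local Notation P := (clique_poset G lambda).
Local Notation lt_adj := (lt_adj G lambda).
Local Notation clique := (clique G lambda).
Local Notation rk := (fun v : {set T} => #|v|).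

(** Pairs meeting [uv] in one end are covered by the definition of conditioning vertices; pairs of
    conditioning vertices need chordality. *)
Lemma principal_clique_lt u v x y : adj G u v ->
  x \in K [set u; v] -> y \in K [set u; v] -> x != y ->
  [set x; y] != [set u; v] -> lt_adj (lambda [set u; v]) x y.
Proof.
move=> uv; have uN h : h \in cond [set u; v] ->
    lt_adj (lambda [set u; v]) u h /\ lt_adj (lambda [set u; v]) v h.
  by rewrite (mem_cond HG) => /andP.
rewrite !in_setU !in_set1 => /orP[/orP[]/eqP->|xN] /orP[/orP[]/eqP->|yN];
  rewrite ?eqxx // => xy ne.
- by have [] := uN _ yN.
- by rewrite setUC eqxx in ne.
- by have [] := uN _ yN.
- by rewrite lt_adjC; have [] := uN _ xN.
- by rewrite lt_adjC; have [] := uN _ xN.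
- by apply: (cond_clique HG uv) => //; apply: lt_adj_chordal.
Qed.

(** For the converse, a clique [S] with at least two vertices lies in [K [set u; v]] for some [uv]
    in it; that label is below [#|S|], so the principal clique has at most [#|S|] elements and
    equals [S]. *)
Lemma clique_posetP S :
  reflect [/\ S \subset vertices G, 0 < #|S| & clique #|S| S] (S \in P).
Proof.
rewrite in_setU; apply: (iffP orP) => [[] /imsetP[]|[SG S0 cS]].
- move=> i iG ->; rewrite sub1set iG cards1; split=> //.
  by move=> x y /set1P-> /set1P->; rewrite eqxx.
- move=> e /(edge_pair HG)[u [v [-> uv]]] ->; rewrite (card_principal HG uv); split=> //.
    have /andP[uG vG] := adj_vertices HG uv.
    by rewrite subUset subUset !sub1set uG vG /=; apply/subsetP=> h; rewrite inE => /andP[].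
  move=> x y xK yK xy; rewrite (lt_adjS G).
  have [E|ne] := eqVneq [set x; y] [set u; v].
    by rewrite /adj E eqxx -/(adj G u v) uv orbT.
  by rewrite (principal_clique_lt uv).
- have [S1|S1] := leqP #|S| 1.
    left; have /cards1P[i E] : #|S| == 1 by rewrite eqn_leq S1.
    by apply/imsetP; exists i; rewrite // (subsetP SG) // E inE.
  right; have [u [v [uS vS uv sub]]] := clique_sub_principal HG S1 cS.
  have := cS _ _ uS vS uv; rewrite lt_adjE => /andP[uvG luv].
  apply/imsetP; exists [set u; v] => //.
  by apply/eqP; rewrite eqEcard sub (card_principal HG).
Qed.

Lemma tight_top S : S \in P -> 1 < #|S| ->
  exists u v, [/\ u \in S, v \in S, adj G u v, S = K [set u; v]
    & {in S &, forall x y, x != y ->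
       [set x; y] != [set u; v] -> lt_adj #|S|.-1 x y}].
Proof.
rewrite in_setU => /orP[]/imsetP[]; first by move=> i _ ->; rewrite cards1.
move=> e /(edge_pair HG)[u [v [-> uv]]] -> _; exists u, v.
split=> //; rewrite ?in_setU ?in_set1 ?eqxx ?orbT //.
by rewrite (card_principal HG) //= => x y; apply: principal_clique_lt.
Qed.

Lemma lambda_principal u v : adj G u v -> lambda [set u; v] = #|K [set u; v]|.-1.
Proof. by move=> uv; rewrite (card_principal HG). Qed.

Lemma principal_clique_in u v : adj G u v -> K [set u; v] \in P.
Proof. by move=> uv; rewrite in_setU; apply/orP; right; apply: imset_f. Qed.

(** Deleting [u] destroys the only pair whose label may reach [#|S|.-1], so the rest satisfies the
    bound for its own, smaller size. *)
Lemma tight_D1 S (u v : T) : S \in P -> 1 < #|S| -> u \in S ->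
  {in S &, forall x y, x != y -> [set x; y] != [set u; v] -> lt_adj #|S|.-1 x y} ->
  S :\ u \in P.
Proof.
move=> /clique_posetP[SG _ _] S1 uS lt.
have c : #|S :\ u| = #|S|.-1 by rewrite (cardsD1 u S) uS.
apply/clique_posetP; split; rewrite ?c; last 1 first.
- move=> x y; rewrite !in_setD1 => /andP[xu xS] /andP[yu yS] xy.
  apply: lt => //; rewrite set2_eq (negPf xu) (negPf yu) andbF //.
- by apply: subset_trans SG; apply: subsetDl.
- by case: #|S| S1 => [|[]].
Qed.

(** A member [A] containing both ends of the top edge [uv] would have [#|A|] above its label
    [#|S|.-1], so it could not be proper. *)
Lemma tight_split S : S \in P -> 1 < #|S| ->
  exists u v, [/\ u \in S, v \in S, adj G u v & S = K [set u; v]] /\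
    [/\ S :\ u \in P, S :\ v \in P
      & forall A, A \in P -> A \proper S -> (A \subset S :\ u) || (A \subset S :\ v)].
Proof.
move=> SP S1; have [u [v [uS vS uv SE lt]]] := tight_top SP S1.
exists u, v; split=> //; split.
- exact: tight_D1 lt.
- by apply: (@tight_D1 _ v u) => // x y xS yS xy; rewrite [[set v; u]]setUC; apply: lt.
move=> A /clique_posetP[_ _ cA] AS; have /andP[sAS _] := AS.
rewrite !subsetD1 sAS /= -negb_and; apply/negP => /andP[uA vA].
have := cA _ _ uA vA (adj_neq HG uv).
rewrite lt_adjE uv lambda_principal // -SE /=.
by have := proper_card AS; lia.
Qed.

Lemma clique_poset_ltE (A S : {set T}) : (A < S)%O = (A \proper S).
Proof. by rewrite Order.POrderTheory.lt_neqAle properEneq. Qed.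

(** A proper member lies in [S :\ u] or [S :\ v], which are members strictly below [S]; if [S]
    covers it, it equals one of them. *)
Lemma clique_poset_coversE S A :
  covers P S A = [&& A \in P, S \in P, A \subset S & #|S| == #|A|.+1].
Proof.
rewrite /covers; case: (boolP (A \in P)) => //= AP; case: (boolP (S \in P)) => //= SP.
rewrite clique_poset_ltE; apply/andP/andP => [[AS /existsPn no]|[AS /eqP cS]].
  split; first exact: proper_sub.
  have A0 : 0 < #|A| by case/clique_posetP: AP.
  have S1 : 1 < #|S| by apply: leq_ltn_trans (proper_card AS).
  have [u [v [[uS vS uv SE] [uP vP sub]]]] := tight_split SP S1.
  have eqD1 x : x \in S -> S :\ x \in P -> A \subset S :\ x -> A = S :\ x.
    move=> xS xP Ax; apply/eqP; rewrite eqEproper Ax /=; apply/negP=> Apx.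
    have := no (S :\ x); rewrite xP !clique_poset_ltE Apx /=.
    by rewrite properD1.
  have /orP[/(eqD1 _ uS uP)->|/(eqD1 _ vS vP)->] := sub _ AP AS.
    by rewrite (cardsD1 u S) uS.
  by rewrite (cardsD1 v S) vS.
split; first by rewrite properEcard AS cS ltnSn.
apply/existsPn => B; rewrite !clique_poset_ltE; apply/and3P => -[_ AB BS].
by have := proper_card AB; have := proper_card BS; lia.
Qed.

Lemma mem_minimal S : (S \in minimal_elements P) = (S \in P) && (#|S| == 1).
Proof.
rewrite inE; case: (boolP (S \in P)) => //= SP.
have S0 : 0 < #|S| by case/clique_posetP: SP.
apply/existsPn/eqP => [no|c A].
  apply/eqP; rewrite eqn_leq S0 andbT leqNgt; apply/negP=> S1.
  have [u [v [[uS _ _ _] [uP _ _]]]] := tight_split SP S1.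
  by have := no (S :\ u); rewrite uP clique_poset_ltE properD1.
rewrite clique_poset_ltE; apply/andP=> -[/clique_posetP[_ A0 _] /proper_card].
by rewrite c; lia.
Qed.

Lemma clique_poset_dim : poset_dim P = #|vertices G|.
Proof.
rewrite /poset_dim -(card_imset _ (@set1_inj T)); apply: eq_card => S.
rewrite mem_minimal; apply/andP/imsetP => [[/clique_posetP[SG _ _] /cards1P[i E]]|[i iG ->]].
  by exists i; rewrite // (subsetP SG) // E inE.
rewrite cards1; split=> //; apply/clique_posetP; rewrite cards1 sub1set; split=> //.
by move=> x y /set1P-> /set1P->; rewrite eqxx.
Qed.

Lemma covered_by_tight S : S \in P -> 1 < #|S| ->
  exists u v, [/\ u \in S, v \in S, adj G u v & S = K [set u; v]] /\
    [/\ S :\ u \in P, S :\ v \in P, S :\ u != S :\ v,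
        covered_by P S = [set S :\ u; S :\ v]
      & forall A, A \in P -> A \proper S -> (A \subset S :\ u) || (A \subset S :\ v)].
Proof.
move=> SP S1; have [u [v [[uS vS uv SE] [uP vP sub]]]] := tight_split SP S1.
exists u, v; do !split=> //.
  apply: contra (adj_neq HG uv) => /eqP/setP/(_ u).
  by rewrite !in_setD1 eqxx uS !andbT => E; apply: negbFE; rewrite -E.
apply/setP=> A; rewrite inE in_set2 clique_poset_coversE SP /=.
apply/and3P/orP => [[AP AS /eqP c]|[] /eqP->].
- have pAS : A \proper S by rewrite properEcard AS c ltnSn.
  have cD x : x \in S -> A \subset S :\ x -> A == S :\ x.
    by move=> xS Ax; rewrite eqEcard Ax -ltnS -c (cardsD1 x S) xS ltnSn.
  by case/orP: (sub _ AP pAS) => /cD E; [left|right]; apply: E.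
- by rewrite uP subsetDl (cardsD1 u S) uS.
- by rewrite vP subsetDl (cardsD1 v S) vS.
Qed.

(** * Level graphs and the vine axioms *)

Lemma level_adj i A B : 0 < i -> adj (level_graph P rk i) A B ->
  exists u v, [/\ adj G u v, lambda [set u; v] = i, A = K [set u; v] :\ u
    & B = K [set u; v] :\ v].
Proof.
move=> i0 /imsetP[S]; rewrite inE => /andP[SP /eqP cS] E.
have S1 : 1 < #|S| by rewrite cS.
have [u [v [[uS vS uv SE] [_ _ _ cov _]]]] := covered_by_tight SP S1.
have lu : lambda [set u; v] = i by rewrite lambda_principal // -SE cS.
move/eqP: E; rewrite cov SE set2_eq => /orP[]/andP[/eqP-> /eqP->].
  by exists u, v.
by exists v, u; rewrite [[set v; u]]setUC adjC; split.
Qed.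

Lemma cards_principal_D1 u v x : adj G u v -> x \in K [set u; v] ->
  #|K [set u; v] :\ x| = lambda [set u; v].
Proof.
move=> uv xK; have := card_principal HG uv.
by rewrite (cardsD1 x) xK => -[].
Qed.

Lemma mem_principal u v : (u \in K [set u; v]) && (v \in K [set u; v]).
Proof. by rewrite !in_setU !in_set1 !eqxx orbT. Qed.

Lemma principal_minus_cond u v x :
  x \in K [set u; v] -> x \notin cond [set u; v] -> (x == u) || (x == v).
Proof. by rewrite !in_setU !in_set1 => /orP[|->]. Qed.

Lemma level_acyclic i c : 0 < i -> ~ is_cycle (level_graph P rk i) c.
Proof.
move=> i0 []; case: c => [|A [|B [|C c]]] // _ /andP[cyc unq].
have /(level_adj i0)[u [v [uv luv AE BE]]] : adj (level_graph P rk i) A B.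
  by case/andP: cyc.
pose R := rel_in (fun x y => lt_adj i.+1 x y && ([set x; y] != [set u; v]))
             (~: cond [set u; v]).
have sep : ~~ connect R u v.
  by rewrite /R -luv; apply: (cond_separates HG uv); apply: lt_adj_chordal.
have nuv := adj_neq HG uv.
have [uK vK] := andP (mem_principal u v).
have uN : u \notin cond [set u; v] by rewrite (mem_cond HG) lt_adj_irr.
have vN : v \notin cond [set u; v] by rewrite (mem_cond HG) lt_adj_irr ?andbF.
have/negP := sep; apply.
(* Invariant along the rest of the cycle, from [B] to [A]. It holds at [B], whose only vertex off
   the conditioning set is [u]; at [A], which contains [v], it contradicts [sep]. *)
pose I (S : {set T}) := forall x, x \in S -> x \notin cond [set u; v] -> connect R u x.
suff IA : I A by apply: (IA v); rewrite // AE in_setD1 eq_sym nuv.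
apply: (connect_invariant _ (cycle_avoid cyc unq)); last first.
  move=> x; rewrite BE in_setD1 => /andP[xv xK] xN.
  have := principal_minus_cond xK xN; rewrite (negPf xv) orbF => /eqP->.
  exact: connect0.
move=> S S' IS /andP[/(level_adj i0)[a [b [ab lab SE S'E]]] ne].
have [aK bK] := andP (mem_principal a b).
have fne : [set a; b] != [set u; v].
  apply: contraNneq ne => E.
  have : [set a; b] == [set u; v] by rewrite E.
  rewrite set2_eq SE S'E AE BE E => /orP[]/andP[/eqP-> /eqP->] //.
  by rewrite setUC.
have cS : #|S| = i by rewrite SE cards_principal_D1.
(* [S] has [i] elements but there are only [i - 1] conditioning vertices. Any [y] in [S'] lies with
   [x] in the clique of [ab], hence is equal or adjacent to it. *)
have [x xS xN] : exists2 x, x \in S & x \notin cond [set u; v].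
  apply/subsetPn; apply/negP => /subset_leq_card.
  by rewrite cS card_cond // luv leqNgt ltn_predL i0.
have KS z : z \in K [set a; b] :\ a \/ z \in K [set a; b] :\ b -> z \in K [set a; b].
  by rewrite !in_setD1 => -[]/andP[].
move=> y yS' yN; apply: (connect_trans (IS _ xS xN)).
have [->|xy] := eqVneq x y; first exact: connect0.
have xK : x \in K [set a; b] by apply: KS; left; rewrite -SE.
have yK : y \in K [set a; b] by apply: KS; right; rewrite -S'E.
apply: connect1; rewrite /R /rel_in !in_setC xN yN !andbT (lt_adjS G).
have [E|ne'] := eqVneq [set x; y] [set a; b].
  by rewrite E fne -lab /Defs.adj E -/(Defs.adj G a b) ab eqxx orbT.
have lt : lt_adj i x y by rewrite -lab; apply: principal_clique_lt.
rewrite lt; apply: contraTneq lt => E.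
by rewrite lt_adjE E luv ltnn andbF.
Qed.

Lemma level_forest i : 0 < i -> forest (level_graph P rk i).
Proof.
move=> i0; split=> [e|c]; last exact: level_acyclic.
move=> /imsetP[S]; rewrite inE => /andP[SP /eqP cS] ->.
have S1 : 1 < #|S| by rewrite cS.
have [u [v [[uS vS uv SE] [uP vP nuv -> _]]]] := covered_by_tight SP S1.
split; last by rewrite cards2 nuv.
have c x : x \in S -> #|S :\ x| == i.
  by move=> xS; move: cS; rewrite (cardsD1 x) xS add1n => -[->].
by apply/subsetP=> A; rewrite in_set2 /= => /orP[]/eqP->; rewrite inE ?uP ?vP c.
Qed.

Lemma clique_poset_vine : vine (T := {set T}) P rk.
Proof.
split.
- split.
  + by move=> x y _ _; rewrite clique_poset_ltE; apply: proper_card.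
  + by move=> x y _ _; rewrite clique_poset_coversE => /and4P[_ _ _ /eqP].
  + by move=> x; rewrite mem_minimal => /andP[_ /eqP].
- move=> S SP; rewrite mem_minimal SP /= => S1.
  have {}S1 : 1 < #|S| by case/clique_posetP: SP => _ S0 _; rewrite ltn_neqAle eq_sym S1.
  have [u [v [_ [_ _ nuv -> _]]]] := covered_by_tight SP S1.
  by rewrite cards2 nuv.
- move=> x y _ _ xy cxy.
  (* A common cover has just one element more than [x], so it is the union of the two distinct
     sets. *)
  have union v : covers P v x -> covers P v y -> v = x :|: y.
    rewrite !clique_poset_coversE => /and4P[_ _ xv /eqP cv] /and4P[_ _ yv _].
    apply/esym/eqP; rewrite eqEcard subUset xv yv cv /=.
    apply: proper_card; rewrite properE subsetUl /=.
    apply: contra xy => /subsetP sub; rewrite eq_sym eqEcard cxy leqnn andbT.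
    by apply/subsetP => z zy; apply: sub; rewrite inE zy orbT.
  by move=> v w vx vy wx wy; rewrite (union v) // (union w).
- by move=> i /andP[i0 _]; apply: level_forest.
Qed.

(* If the top edge f of S \ u missed v, it would also be the top edge of S \ v,
   whence S \ u = K_f = S \ v. *)
Lemma tight_D2 S (u v : T) : S \in P -> 2 < #|S| -> u \in S -> v \in S ->
  u != v -> S :\ u \in P -> S :\ v \in P -> S :\ u :\ v \in P.
Proof.
move=> SP S2 uS vS uv uP vP.
have cu : #|S :\ u| = #|S|.-1 by rewrite (cardsD1 u S) uS.
have cv : #|S :\ v| = #|S|.-1 by rewrite (cardsD1 v S) vS.
have [|a [b [aS bS ab SE lt]]] := tight_top uP; first by rewrite cu -ltnS prednK // ltnW // ltnW.
have vu : v \in S :\ u by rewrite in_setD1 eq_sym uv.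
have su : 1 < #|S :\ u| by rewrite cu -ltnS prednK // ltnW // ltnW.
have [/eqP E|va] := boolP (v == a).
  by subst a; apply: (@tight_D1 _ v b).
have [/eqP E|vb] := boolP (v == b).
  subst b; apply: (@tight_D1 _ v a) => // x y xS yS xy.
  by rewrite [[set v; a]]setUC; apply: lt.
have [|c [d [cS dS cd SE' lt']]] := tight_top vP; first by rewrite cv -ltnS prednK // ltnW // ltnW.
have aS' : a \in S :\ v by move: aS; rewrite !in_setD1 [a == v]eq_sym va => /andP[_ ->].
have bS' : b \in S :\ v by move: bS; rewrite !in_setD1 [b == v]eq_sym vb => /andP[_ ->].
(* [ab] has label [#|S|.-2], which only the top edge of [S :\ v] attains. *)
have E : [set a; b] = [set c; d].
  apply/eqP/negPn/negP => /(lt' _ _ aS' bS' (adj_neq HG ab)).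
  by rewrite lt_adjE lambda_principal // -SE cu cv ltnn andbF.
by have := vu; rewrite SE E -SE' in_setD1 eqxx.
Qed.

(** Elements covered by [S] are among [S :\ u] and [S :\ v], and both of these cover [S :\ u :\ v],
    a member by [tight_D2]. *)
Lemma clique_poset_proximity : proximity (T := {set T}) P rk.
Proof.
move=> i x y i2; rewrite inE => /andP[xP /eqP/= cx]; rewrite inE => /andP[yP /eqP/= cy] xy [S].
rewrite !clique_poset_coversE => /andP[/and4P[_ SP xS /eqP cS] /and4P[_ _ yS _]].
have S1 : 1 < #|S| by rewrite cS cx ltnS ltnW.
have [u [v [[uS vS uv SE] [uP vP _ cov _]]]] := covered_by_tight SP S1.
have [mx my] : x \in [set S :\ u; S :\ v] /\ y \in [set S :\ u; S :\ v].
  by rewrite -cov; split; rewrite inE clique_poset_coversE ?xP ?yP SP ?xS ?yS cS ?cx ?cy eqxx.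
have NP : S :\ u :\ v \in P by apply: tight_D2; rewrite ?cS ?cx ?(adj_neq HG uv).
exists (S :\ u :\ v).
have NE : S :\ u :\ v = S :\ v :\ u by rewrite !setDDl setUC.
have nuv := adj_neq HG uv.
have cN : #|S| = #|S :\ u :\ v|.+2.
  by rewrite (cardsD1 u S) (cardsD1 v (S :\ u)) uS in_setD1 vS eq_sym nuv.
suff : {in [set S :\ u; S :\ v], forall z, covers P z (S :\ u :\ v)} by move=> H; rewrite !H.
move=> z; rewrite in_set2 clique_poset_coversE NP => /orP[]/eqP->.
  by rewrite uP subsetDl /=; move: cN; rewrite (cardsD1 u S) uS add1n => -[->].
by rewrite vP {1}NE subsetDl /=; move: cN; rewrite (cardsD1 v S) vS add1n => -[->].
Qed.

(** Below the top, level [i] under [S] is the union of those under [S :\ u] and [S :\ v], connected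
    by induction. They are linked by the edge of [S] itself if [i] is [#|S|.-1], and otherwise share
    an element under [S :\ u :\ v]; this is why nonemptiness is proved along. *)
Lemma clique_poset_level_connected i S : 0 < i <= #|S| -> S \in P ->
  (exists2 A, A \in level P rk i & A \subset S) /\
  {in level P rk i &, forall A B, A \subset S -> B \subset S ->
     connect (adj (level_graph P rk i)) A B}.
Proof.
move=> /andP[i0]; have [n] := ubnP #|S|; elim: n S => // n IH S Sn iS SP.
have [E|ltiS] := eqVneq i #|S|.
  have top A : A \in level P rk i -> A \subset S -> A = S.
    rewrite inE => /andP[_ /eqP/= cA] AS.
    by apply/eqP; rewrite eqEcard AS cA E leqnn.
  split; first by exists S; rewrite // inE SP /= E.
  by move=> A B Ai Bi /(top _ Ai)-> /(top _ Bi)->; exact: connect0.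
have {}ltiS : i < #|S| by rewrite ltn_neqAle ltiS.
have S1 : 1 < #|S| by apply: leq_ltn_trans ltiS.
have [u [v [[uS vS uv SE] [uP vP nuv cov sub]]]] := covered_by_tight SP S1.
have cD x : x \in S -> #|S :\ x| = #|S|.-1 by move=> xS; rewrite (cardsD1 x S) xS.
have ltD x : x \in S -> #|S :\ x| < n /\ i <= #|S :\ x|.
  by move=> xS; rewrite cD //; clear -Sn ltiS; lia.
have [ltu leu] := ltD u uS; have [ltv lev] := ltD v vS.
have [[Au Aui sAu] cu] := IH _ ltu leu uP.
have [_ cv] := IH _ ltv lev vP.
split; first by exists Au => //; apply: subset_trans sAu (subsetDl _ _).
have adjC' : connect_sym (adj (level_graph P rk i)).
  by apply: sym_connect_sym => A B; rewrite /Defs.adj setUC.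
have [A0 [B0 [A0i B0i A0u B0v cAB]]] : exists A0 B0, [/\ A0 \in level P rk i,
    B0 \in level P rk i, A0 \subset S :\ u, B0 \subset S :\ v
    & connect (adj (level_graph P rk i)) A0 B0].
  have [E|ne] := eqVneq i #|S|.-1.
    have in_level x : x \in S -> S :\ x \in P -> S :\ x \in level P rk i.
      by move=> xS xP; rewrite inE xP /= cD // E.
    exists (S :\ u), (S :\ v); split; rewrite ?in_level //.
    apply: connect1; apply/imsetP; exists S; last by rewrite cov.
    by rewrite inE SP /= E (ltn_predK S1).
  have S2 : 2 < #|S| by clear -i0 ltiS ne; lia.
  have NP : S :\ u :\ v \in P by apply: tight_D2; rewrite ?(adj_neq HG uv).
  have cN : #|S :\ u :\ v| = #|S|.-2.
    rewrite (cardsD1 u S) (cardsD1 v (S :\ u)) uS in_setD1 vS.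
    by rewrite eq_sym (adj_neq HG uv).
  have [ltN leN] : #|S :\ u :\ v| < n /\ i <= #|S :\ u :\ v| by rewrite cN; clear -Sn ltiS ne; lia.
  have [[A Ai sA] _] := IH _ ltN leN NP.
  exists A, A; split=> //; first by apply: subset_trans sA (subsetDl _ _).
  by apply: subset_trans sA _; rewrite setDDl setUC -setDDl subsetDl.
have reach A : A \in level P rk i -> A \subset S ->
    connect (adj (level_graph P rk i)) A0 A.
  move=> Ai AS; have /andP[AP /eqP/= cA] : (A \in P) && (rk A == i) by move: Ai; rewrite inE.
  have pAS : A \proper S by rewrite properEcard AS cA.
  case/orP: (sub _ AP pAS) => sA; first exact: cu.
  by apply: connect_trans cAB _; apply: cv.
by move=> A B Ai Bi AS BS; apply: (connect_trans (y := A0)); rewrite ?reach // adjC' reach.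
Qed.

Lemma clique_poset_complete_R_vine :
  complete_graph G -> R_vine (T := {set T}) P rk.
Proof.
move=> Gc.
have sub S : S \in P -> S \subset vertices G by case/clique_posetP.
(* The vertex set is the top element: each principal clique fits inside it, which bounds every label
   below [#|vertices G|]. *)
have VP : 0 < #|vertices G| -> vertices G \in P.
  move=> V0; apply/clique_posetP; split=> // x y xV yV xy.
  have xyG := Gc _ _ xV yV xy; rewrite lt_adjE xyG lambda_principal //=.
  have /clique_posetP[/subset_leq_card le K0 _] := principal_clique_in xyG.
  by apply: leq_trans le; rewrite ltn_predL.
have rank : poset_rank P rk = #|vertices G|.
  apply/eqP; rewrite eqn_leq; apply/andP; split.
    by apply/bigmax_leqP => S /sub; apply: subset_leq_card.
  by have [->//|/VP VP'] := posnP #|vertices G|; apply: leq_bigmax_cond.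
split.
- exact: clique_poset_vine.
- by rewrite rank clique_poset_dim.
- move=> i; rewrite rank => /andP[i0 iV].
  have [||[A Ai _] conn] := @clique_poset_level_connected i (vertices G).
    by rewrite i0.
  + by apply: VP; apply: leq_trans iV.
  split; first exact: level_forest.
    by apply/set0Pn; exists A.
  move=> B C Bi Ci; apply: conn => //; apply: sub.
    by move: Bi; rewrite inE => /andP[].
  by move: Ci; rewrite inE => /andP[].
- exact: clique_poset_proximity.
Qed.

End CliquePoset.

(** * Principal ideals as clique posets of induced graphs *)

Section PrincipalIdeals.
Set Implicit Arguments.
Unset Strict Implicit.
Unset Printing Implicit Defensive.
Variables (T : finType) (G : graph T) (lambda : {set T} -> nat).
Hypothesis HG : MAT_labeled_graph G lambda.
Implicit Types (S A B e : {set T}).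

Local Notation cond := (conditioning_vertices G lambda).
Local Notation K := (principal_clique G lambda).
Local Notation P := (clique_poset G lambda).
Local Notation rk := (fun v : {set T} => #|v|).

Definition induced_graph S := Graph S [set e in edges G | e \subset S].

(** An edge other than the top edge of [S] misses one of its ends [x], hence lies in the smaller
    member [S :\ x]. *)
Lemma principal_clique_sub S e :
  S \in P -> e \in edges G -> e \subset S -> K e \subset S.
Proof.
move=> SP eG eS; have [sG _ _] := HG; have [_ ce] := sG _ eG.
have [n] := ubnP #|S|; elim: n S SP eS => // n IH S SP eS; rewrite ltnS => Sn.
have S1 : 1 < #|S| by rewrite -ce subset_leq_card.
have [u [v [[uS vS uv SE] [uP vP _]]]] := tight_split HG SP S1.
have [->|ne] := eqVneq e [set u; v]; first by rewrite -SE.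
have IHD x : x \in S -> S :\ x \in P -> x \notin e -> K e \subset S.
  move=> xS xP xe; apply: subset_trans (subsetDl S [set x]).
  apply: IH => //; first by rewrite subsetD1 eS.
  by apply: leq_trans Sn; rewrite proper_card // properD1.
have [ue|/IHD-> //] := boolP (u \in e); have [ve|/IHD-> //] := boolP (v \in e).
case/eqP: ne; apply/esym/eqP; rewrite eqEcard subUset !sub1set ue ve ce.
by rewrite cards2 (adj_neq HG uv).
Qed.

Lemma induced_conditioning_vertices S e : S \in P -> e \in edges G -> e \subset S ->
  conditioning_vertices (induced_graph S) lambda e = cond e.
Proof.
move=> SP eG eS; have /subsetP KS := principal_clique_sub SP eG eS.
have /subsetP SG : S \subset vertices G by case/(clique_posetP HG): SP.
apply/setP=> h; apply/idP/idP => hc.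
  move: hc; rewrite !inE /= => /andP[/SG-> /forallP H] /=.
  apply/forallP=> u; apply/implyP => ue; have := H u.
  by rewrite ue !inE /= => /andP[/andP[-> _] ->].
have hS : h \in S by apply: KS; rewrite in_setU hc orbT.
move: hc; rewrite !inE /= hS => /andP[_ /forallP H].
apply/forallP=> u; apply/implyP => ue; have := H u.
rewrite ue !inE /= => /andP[-> ->].
by rewrite subUset !sub1set hS (subsetP eS).
Qed.

(** ML1 passes to any subgraph; ML2 survives because [S] contains all conditioning vertices of its
    edges. *)
Lemma induced_MAT_labeled S : S \in P -> MAT_labeled_graph (induced_graph S) lambda.
Proof.
move=> SP; have [sG l0 ml] := HG.
have inG e : e \in edges (induced_graph S) -> e \in edges G /\ e \subset S.
  by rewrite inE => /andP.
split=> [e /inG[eG eS]|e /inG[/l0]//|k k0].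
  by have [_ ->] := sG _ eG.
have [ml1 ml2] := ml k k0; split.
  move=> e c; rewrite inE => /andP[/inG[eG eS] ek] [sc /andP[cyc uc]] ec sub.
  apply: (ml1 e c) => //; first by rewrite inE eG.
    by split=> //; apply/andP; split=> //; apply: sub_cycle cyc => x y /inG[].
  apply: subset_trans sub _; apply/setUS/subsetP => f.
  by rewrite !inE => /andP[/andP[-> _] ->].
move=> e; rewrite inE => /andP[/inG[eG eS] ek].
by rewrite induced_conditioning_vertices // ml2 // inE eG.
Qed.

Lemma induced_clique_poset S : S \in P ->
  clique_poset (induced_graph S) lambda = principal_ideal (T := {set T}) P S.
Proof.
move=> SP; have /(clique_posetP HG)[SG _ _] := SP.
have KE e : e \in edges G -> e \subset S ->
    principal_clique (induced_graph S) lambda e = K e.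
  by move=> eG eS; rewrite /principal_clique induced_conditioning_vertices.
apply/setP=> A; rewrite [RHS]inE -[(A <= S)%O]/(A \subset S); apply/setUP/andP.
  move=> [] /imsetP[].
    move=> i iS ->; rewrite sub1set iS in_setU; split=> //.
    by apply/orP; left; rewrite imset_f // (subsetP SG).
  move=> e; rewrite inE => /andP[eG eS] ->; rewrite KE //.
  by rewrite principal_clique_sub // in_setU imset_f ?orbT.
rewrite in_setU => -[/orP[] /imsetP[] x xG -> sub]; [left|right].
  by rewrite imset_f // -sub1set.
have xS : x \subset S by apply: subset_trans sub; apply: subsetUl.
by rewrite -KE // imset_f // inE xG.
Qed.

Lemma clique_poset_LR_vine : LR_vine (T := {set T}) P rk.
Proof.
split=> [|S SP]; first exact: clique_poset_vine.
rewrite -induced_clique_poset //.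
apply: clique_poset_complete_R_vine; first exact: induced_MAT_labeled.
have /(clique_posetP HG)[_ _ cS] := SP; move=> x y xS yS /(cS _ _ xS yS).
by rewrite lt_adjE /adj inE subUset !sub1set xS yS => /andP[-> _].
Qed.

End PrincipalIdeals.

Theorem theorem4p13 (l : nat) (G : graph 'I_l) (lambda : {set 'I_l} -> nat)
  (HV : vertices G = [set: 'I_l])
  (HG : MAT_labeled_graph G lambda) :
  let rk := fun v : {set 'I_l} => #|v| in
  LR_vine (T := {set 'I_l}) (clique_poset G lambda) rk /\
  (complete_graph G -> R_vine (T := {set 'I_l}) (clique_poset G lambda) rk).
Proof.
split; first exact: clique_poset_LR_vine.
exact: clique_poset_complete_R_vine.
Qed.
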